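(* Let $\{1_G\}$ be the trivial group, let $\{e\}$ be a singleton set, and let $\zeta$ be the soft indiscrete topology on $\{1_G\}$ with parameter set $\{e\}$. Then $(\{1_G\},\zeta)_{\{e\}}$ is the terminal object in the category $\mathbf{STGrp}$ of soft topological groups.
   Context: A soft set over a set $X$ with parameter set $\xi$ is a function $W\colon\xi\to\mathcal{P}(X)$. Soft union, soft intersection and soft inclusion $\widetilde{\sqsubseteq}$ of soft sets with the same parameter set are taken parameterwise; if $\eta\subseteq\xi$, a soft set $V$ with parameter set $\eta$ satisfies $V\,\widetilde{\sqsubseteq}\,W$ if $V(e)\subseteq W(e)$ for all $e\in\eta$. $\emptyset_\xi(e)=\emptyset$ and $X_\xi(e)=X$ for all $e\in\xi$. For $x\in X$, $x\,\widetilde{\in}\,W$ means $x\in W(e)$ for every parameter $e$ of $W$. A soft topology $\zeta$ on $X$ with parameter set $\xi$ is a collection of soft sets over $X$ (with parameter set $\xi$) containing $\emptyset_\xi$ and $X_\xi$ and closed under arbitrary soft unions and under soft intersections of two members; members of $\zeta$ are soft open. The soft indiscrete topology is $\{\emptyset_\xi,X_\xi\}$. A soft open neighborhood of $x$ is a $W\in\zeta$ with $x\,\widetilde{\in}\,W$. For functions $\varphi\colon\xi\to\xi'$ and $\varrho\colon X\to X'$, the image $(\varphi,\varrho)(W)$ of a soft set $W$ over $X$ is the soft set over $X'$ with parameter set $\varphi(\xi)$ given by $(\varphi,\varrho)(W)(d)=\bigcup_{\varphi(e)=d}\varrho(W(e))$. The pair $(\varphi,\varrho)\colon(X,\zeta)_\xi\to(X',\zeta')_{\xi'}$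 is soft continuous if for every $x\in X$ and every soft open neighborhood $W'$ of $\varrho(x)$ there is a soft open neighborhood $W$ of $x$ with $\varrho(x)\,\widetilde{\in}\,(\varphi,\varrho)(W)\,\widetilde{\sqsubseteq}\,W'$. A soft topological group $(G,\zeta)_\xi$ is a group $(G,\ast)$ with a soft topology $\zeta$ on $G$ with parameter set $\xi$ such that (i) for all $a,b\in G$ and every soft open neighborhood $W$ of $a\ast b$ there are soft open neighborhoods $U$ of $a$ and $V$ of $b$ with $U\ast V\,\widetilde{\sqsubseteq}\,W$, where $(U\ast V)(e)=U(e)\ast V(e)$; and (ii) with $\iota(a)=a^{-1}$, the mapping $(\mathbb{I}_\xi,\iota)$ from $(G,\zeta)_\xi$ to itself is soft continuous. $\mathbf{STGrp}$ is the category whose objects are soft topological groups and whose morphisms $(\varphi,\varrho)\colon(G,\zeta)_\xi\to(G',\zeta')_{\xi'}$ are the soft continuous mappings with $\varphi\colon\xi\to\xi'$ a function and $\varrho\colon G\to G'$ a group homomorphism, with componentwise composition $(\varphi_2,\varrho_2)\circ(\varphi_1,\varrho_1)=(\varphi_2\circ\varphi_1,\varrho_2\circ\varrho_1)$ and identities $(\mathbb{I}_\xi,\mathbb{I}_G)$. *)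

(* Defs.v *)
From HB Require Import structures.
From mathcomp Require Import all_boot.
From mathcomp Require Import boolp classical_sets.

Set Implicit Arguments.
Unset Strict Implicit.
Unset Printing Implicit Defensive.

Local Open Scope classical_set_scope.
Local Open Scope group_scope.

Definition soft_set (E X : Type) := E -> set X.

Section SoftSets.
Variables E X : Type.
Implicit Types (U V W : soft_set E X) (F : set (soft_set E X)) (x : X).

Definition soft0 : soft_set E X := fun=> set0.
Definition softT : soft_set E X := fun=> setT.
Definition soft_bigcup F : soft_set E X := fun e => \bigcup_(W in F) W e.
Definition soft_setI U V : soft_set E X := fun e => U e `&` V e.
Definition soft_subset U V := forall e, U e `<=` V e.
Definition soft_in x W := forall e, W e x.

(* Soft inclusion when the parameter set of the left-hand side is a subset
   [A] of that of the right-hand side. *)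
Definition soft_subset_on (A : set E) (V : soft_set A X) (W : soft_set E X) :=
  forall e : A, V e `<=` W (val e).

Record soft_topology (zeta : set (soft_set E X)) : Prop := SoftTopology {
  soft_open0 : zeta soft0;
  soft_openT : zeta softT;
  soft_open_bigcup : forall F, F `<=` zeta -> zeta (soft_bigcup F);
  soft_openI : forall U V, zeta U -> zeta V -> zeta (soft_setI U V)
}.

Definition soft_indiscrete : set (soft_set E X) := [set soft0; softT].

Definition soft_open_nbhd (zeta : set (soft_set E X)) x W :=
  zeta W /\ soft_in x W.

End SoftSets.

(* The parameter set of the image is [range phi], not the whole of [E']. *)
Definition soft_image (E E' X X' : Type) (phi : E -> E') (rho : X -> X')
    (W : soft_set E X) : soft_set (range phi) X' :=
  fun d => \bigcup_(e in [set e | phi e = val d]) (rho @` W e).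
Arguments soft_image {E E' X X'} phi rho W.

Definition soft_continuous (E E' X X' : Type)
    (zeta : set (soft_set E X)) (zeta' : set (soft_set E' X'))
    (phi : E -> E') (rho : X -> X') :=
  forall x W', soft_open_nbhd zeta' (rho x) W' ->
    exists W, [/\ soft_open_nbhd zeta x W,
                  soft_in (rho x) (soft_image phi rho W) &
                  soft_subset_on (soft_image phi rho W) W'].

Definition soft_mul (E : Type) (G : groupType) (U V : soft_set E G) :
    soft_set E G :=
  fun e => [set a * b | a in U e & b in V e].

Record soft_topological_group (E : Type) (G : groupType)
    (zeta : set (soft_set E G)) : Prop := SoftTopologicalGroup {
  stg_topology : soft_topology zeta;
  stg_mul : forall (a b : G) W, soft_open_nbhd zeta (a * b) W ->
    exists U V, [/\ soft_open_nbhd zeta a U, soft_open_nbhd zeta b V &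
                    soft_subset (soft_mul U V) W];
  stg_inv : soft_continuous zeta zeta (@id E) (fun a : G => a^-1)
}.

Record category := Category {
  obj :> Type;
  hom : obj -> obj -> Type;
  idc : forall a, hom a a;
  comp : forall a b c, hom b c -> hom a b -> hom a c;
  comp_idl : forall a b (f : hom a b), comp (idc b) f = f;
  comp_idr : forall a b (f : hom a b), comp f (idc a) = f;
  compA : forall a b c d (h : hom c d) (g : hom b c) (f : hom a b),
    comp h (comp g f) = comp (comp h g) f
}.

Definition terminal (C : category) (t : C) :=
  forall a : C, exists f : hom a t, forall g : hom a t, g = f.

Record stgrp := STGroup {
  stg_param : Type;
  stg_group : groupType;
  stg_open : set (soft_set stg_param stg_group);
  stgP : soft_topological_group stg_open
}.

Record stgrp_hom (A B : stgrp) := STGroupHom {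
  hom_param : stg_param A -> stg_param B;
  hom_group : {multiplicative stg_group A -> stg_group B};
  hom_continuous :
    soft_continuous (@stg_open A) (@stg_open B) hom_param hom_group
}.

Lemma multiplicative_ext (G H : groupType) (f g : {multiplicative G -> H}) :
  f =1 g -> f = g.
Proof.
case: f g => [f [[fM]]] [g [[gM]]] /= /funext fg.
by case: g / fg gM => gM; rewrite (Prop_irrelevance fM gM).
Qed.

Lemma stgrp_hom_ext (A B : stgrp) (f g : stgrp_hom A B) :
  hom_param f =1 hom_param g -> hom_group f =1 hom_group g -> f = g.
Proof.
case: f g => [p r c] [p' r' c'] /= /funext pp' /multiplicative_ext rr'.
by case: p' / pp' c' => c'; case: r' / rr' c' => c'; rewrite (Prop_irrelevance c c').
Qed.

Lemma soft_in_image (E E' X X' : Type) (phi : E -> E') (rho : X -> X')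
    (W : soft_set E X) x :
  soft_in x W -> soft_in (rho x) (soft_image phi rho W).
Proof.
by move=> xW [d dP]; have [e _ eE] := set_mem dP; exists e => //; exists x.
Qed.

Lemma soft_continuous_id (E X : Type) (zeta : set (soft_set E X)) :
  soft_continuous zeta zeta id id.
Proof.
move=> x W' [oW' xW']; exists W'; split => //; first exact: soft_in_image.
by move=> e _ [d /= ->] [y yW' <-].
Qed.

Lemma soft_continuous_comp (E1 E2 E3 X1 X2 X3 : Type)
    (z1 : set (soft_set E1 X1)) (z2 : set (soft_set E2 X2))
    (z3 : set (soft_set E3 X3)) (p1 : E1 -> E2) (r1 : X1 -> X2)
    (p2 : E2 -> E3) (r2 : X2 -> X3) :
  soft_continuous z2 z3 p2 r2 -> soft_continuous z1 z2 p1 r1 ->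
  soft_continuous z1 z3 (p2 \o p1) (r2 \o r1).
Proof.
move=> c2 c1 x W3 /c2[W2 [/c1[W1 [nW1 _ s1]] _ s2]].
exists W1; split => //; first exact: soft_in_image nW1.2.
move=> [d dP] _ [e /= ed] [y yW1 <-].
have dP2 : d \in range p2 by apply/mem_set; exists (p1 e).
have eP1 : p1 e \in range p1 by apply/mem_set; exists e.
apply: (s2 (exist _ d dP2)); exists (p1 e) => //; exists (r1 y) => //.
by apply: (s1 (exist _ (p1 e) eP1)); exists e => //; exists y.
Qed.

Definition stgrp_id (A : stgrp) : stgrp_hom A A :=
  @STGroupHom A A id idfun (@soft_continuous_id _ _ (@stg_open A)).

Definition stgrp_comp (A B C : stgrp) (g : stgrp_hom B C) (f : stgrp_hom A B) :
    stgrp_hom A C :=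
  @STGroupHom A C (hom_param g \o hom_param f) (hom_group g \o hom_group f)
    (soft_continuous_comp (@hom_continuous _ _ g) (@hom_continuous _ _ f)).

Lemma stgrp_comp_idl (A B : stgrp) (f : stgrp_hom A B) :
  stgrp_comp (stgrp_id B) f = f.
Proof. exact: stgrp_hom_ext. Qed.

Lemma stgrp_comp_idr (A B : stgrp) (f : stgrp_hom A B) :
  stgrp_comp f (stgrp_id A) = f.
Proof. exact: stgrp_hom_ext. Qed.

Lemma stgrp_compA (A B C D : stgrp) (h : stgrp_hom C D) (g : stgrp_hom B C)
    (f : stgrp_hom A B) :
  stgrp_comp h (stgrp_comp g f) = stgrp_comp (stgrp_comp h g) f.
Proof. exact: stgrp_hom_ext. Qed.

Definition STGrp : category :=
  Category stgrp_comp_idl stgrp_comp_idr stgrp_compA.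

(* Main.v *)
Require Import Defs.
From mathcomp Require Import all_boot.
From mathcomp Require Import boolp classical_sets.

(** An open neighborhood in a soft indiscrete topology is the whole soft set,
    so every mapping into a soft indiscrete space is soft continuous, and every
    group with the soft indiscrete topology is a soft topological group.
    Continuity being automatic, a morphism into an indiscrete object is just a
    pair of a function between parameter sets and a group homomorphism.  When
    the target group and the target parameter set are singletons, each
    component can be chosen in exactly one way: the trivial homomorphism and
    the constant function. *)

Local Open Scope classical_set_scope.

Lemma soft_topology_indiscrete (E X : Type) :
  soft_topology (@soft_indiscrete E X).
Proof.
split; [by left | by right | |].
- move=> F FI; have [FT|FT] := pselect (F (@softT E X)).
    right; apply/funext => e; apply/seteqP; split=> // x _.
    by exists (@softT E X).
  left; apply/funext => e; apply/seteqP; split=> // x [W FW Wx].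
  have [W0|WT] := FI W FW; first by rewrite W0 in Wx.
  by rewrite WT in FW.
- move=> U V [->|->] [->|->]; [left|left|left|right]; apply/funext => e;
    by rewrite /soft_setI /soft0 /softT ?setI0 ?set0I ?setIT.
Qed.

(** The empty soft set contains no point softly unless there are no
    parameters at all, in which case it coincides with the full one. *)
Lemma soft_indiscrete_nbhdE {E X : Type} {x : X} {W : soft_set E X} :
  soft_open_nbhd (@soft_indiscrete E X) x W -> W = @softT E X.
Proof.
by case=> [[->|->]] // x0; apply/funext => e; have := x0 e.
Qed.

Lemma soft_continuous_indiscrete (E E' X X' : Type)
    (zeta : set (soft_set E X)) (phi : E -> E') (rho : X -> X') :
  soft_topology zeta ->
  soft_continuous zeta (@soft_indiscrete E' X') phi rho.
Proof.
move=> zetaP x W' oW'; rewrite (soft_indiscrete_nbhdE oW').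
exists (@softT E X); split=> //; last exact: soft_in_image.
by split=> //; exact: soft_openT.
Qed.

Lemma soft_topological_group_indiscrete (E : Type) (G : groupType) :
  soft_topological_group (@soft_indiscrete E G).
Proof.
split; first exact: soft_topology_indiscrete.
- move=> a b W oW; rewrite (soft_indiscrete_nbhdE oW).
  by exists (@softT E G), (@softT E G); split=> //; split=> //; right.
- exact/soft_continuous_indiscrete/soft_topology_indiscrete.
Qed.

Theorem theorem6p13 (G : groupType) (trivG : [set: G] = [set 1%g])
    (E : Type) (e : E) (singE : [set: E] = [set e]) :
  exists stgG : soft_topological_group (@soft_indiscrete E G),
    @terminal STGrp (STGroup stgG).
Proof.
have G1 (x : G) : x = 1%g by have : [set: G] x by []; rewrite trivG.
have Ee (d : E) : d = e by have : [set: E] d by []; rewrite singE.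
exists (soft_topological_group_indiscrete E G) => A.
exists (@STGroupHom A (STGroup (soft_topological_group_indiscrete E G))
  (fun=> e) (@one_fun (stg_group A) G)
  (soft_continuous_indiscrete _ _ _ _ _ _ _ (stg_topology (stgP A)))).
move=> g; apply: stgrp_hom_ext => x /=; first exact: Ee.
by rewrite [LHS]G1 [RHS]G1.
Qed.
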